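(* Let $b$ be a complex number and let $m\ge1$ be an integer. Then for all integers $n\ge 0$, $$D_{-m}(b;n)=\det\bigl(M_b(-m+i+j)\bigr)_{i,j=0}^{n-1}=p_{m+1}(-n).$$ Equivalently, $D_{-m}(b;n)=0$ for $1\le n\le m$, and $D_{-m}(b;n)=(-1)^{\binom{m+1}{2}}p_{m+1}(n-m-1)$ for $n\ge m+1$.
   Context: For a complex parameter $b$ and $n\ge0$, $M_b(n)=\sum_{k=0}^{n}\Bigl(\binom{n+k}{k}-\binom{n+k}{k-1}\Bigr)b^{n-k}$ (with $\binom{r}{-1}=0$), extended by $M_b(n)=0$ for $n<0$; equivalently $\sum_{n\ge0}M_b(n)x^n=\frac{C(x)}{1-bxC(x)}$ where $C(x)=\sum_{n\ge0}C_nx^n=\frac{1-\sqrt{1-4x}}{2x}$ is the Catalan generating function. For $m\in\mathbb Z$, $D_m(b;n)=\det(M_b(m+i+j))_{i,j=0}^{n-1}$, the $0\times0$ determinant being $1$. For an integer $m\ge0$, $p_m(n)$ is the polynomial $\prod_{1\le i\le j\le m-1}\frac{2n+i+j}{i+j}$ in $n$ (empty product $=1$). *)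

(* Defs.v *)
From HB Require Import structures.
From mathcomp Require Import all_boot all_order all_algebra.
From mathcomp Require Import complex.
From mathcomp Require Import reals.
Set Implicit Arguments. Unset Strict Implicit. Unset Printing Implicit Defensive.
Import Order.TTheory GRing.Theory Num.Theory.
Local Open Scope ring_scope.

(* M_b(n) for n : int; zero for n < 0.  The k = 0 term uses binom(r,-1) = 0. *)
Definition Mb {F : comNzRingType} (b : F) (n : int) : F :=
  match n with
  | Posz n => \sum_(0 <= k < n.+1)
       (('C(n + k, k))%:R - (if k is k'.+1 then ('C(n + k, k'))%:R else 0)) * b ^+ (n - k)
  | Negz _ => 0
  end.

Definition Dm {F : comNzRingType} (b : F) (m : int) (n : nat) : F :=
  \det (\matrix_(i < n, j < n) Mb b (m + i%:Z + j%:Z)).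

Definition pm {F : fieldType} (m : nat) (x : F) : F :=
  \prod_(1 <= i < m) \prod_(i <= j < m) ((2 * x + (i + j)%:R) / (i + j)%:R).

(* Main.v *)
(* Let f = sum_n M_b(n) x^n and g = 1/f = 1 - b x - x C(x); only the coefficient
   of x in g depends on b.  If L is the lower triangular Toeplitz matrix of g,
   then L A L^T, for A the Hankel matrix of x^m f with n = m + 1 + N rows, has
   generating function (x^(m+1) g(y) - y^(m+1) g(x)) / (x - y), so it is block
   diagonal: an antitriangular block of size m + 1, which contributes the sign
   (-1)^binom(m+1,2), and the Hankel block of the Catalan numbers C_(m+1+i+j) of
   size N.  The latter is an instance of the Hankel determinants of
   hypergeometric moments u_(s+1) / u_s = (x + d s) / (y + s), which column
   elimination reduces to size N - 1 with parameters (x + d, y + 2).  When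
   1 <= n <= m, the first row of A and the factor i = j = n of p_(m+1)(-n)
   vanish. *)
Require Import Defs.
From HB Require Import structures.
From mathcomp Require Import all_boot all_order all_algebra.
From mathcomp Require Import complex reals.
From mathcomp Require Import zify ring.
Set Implicit Arguments. Unset Strict Implicit. Unset Printing Implicit Defensive.
Import Order.TTheory GRing.Theory Num.Theory.
Local Open Scope ring_scope.

(** * Ballot numbers and the recurrence for M_b *)

Section Ballot.
Variable F : comNzRingType.

Definition ballot (n k : nat) : F :=
  'C(n + k, k)%:R - (if k is k'.+1 then 'C(n + k, k')%:R else 0).

Lemma ballot0 n : ballot n 0 = 1.
Proof. by rewrite /ballot bin0 subr0. Qed.

Lemma ballotSS n k : ballot n.+1 k.+1 = ballot n k.+1 + ballot n.+1 k.
Proof.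
rewrite /ballot addSn binS natrD addSnnS; case: k => [|k].
  by rewrite !bin0 !subr0 addrK addrNK.
by rewrite addnS binS [in X in _ - X]binS !natrD; ring.
Qed.

Lemma ballot_diag n : ballot n n.+1 = 0.
Proof.
by rewrite /ballot -[in X in X - _]bin_sub ?leq_addl // addnK addnS subrr.
Qed.

(* The coefficient of [b ^+ e] in [Mb b n], i.e. of [x^n] in [x^e C(x)^(e+1)];
   [bcoef 0] is the Catalan sequence. *)
Definition bcoef (e n : nat) : F := if (e <= n)%N then ballot n (n - e) else 0.

Lemma bcoef_small e n : (n < e)%N -> bcoef e n = 0.
Proof. by move=> h; rewrite /bcoef leqNgt h. Qed.

Lemma bcoef00 : bcoef 0 0 = 1.
Proof. exact: ballot0. Qed.

(** In generating functions: C = 1 + x C^2 multiplied by x^(e+1) C^(e+1). *)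
Lemma bcoefSS e n : bcoef e.+1 n.+1 = bcoef e n + bcoef e.+2 n.+1.
Proof.
rewrite /bcoef !ltnS; have [lt|gt|->] := ltngtP e n; last 2 first.
- by rewrite addr0.
- by rewrite !subnn !ballot0 addr0.
rewrite !subSS; have -> : (n - e = (n - e.+1).+1)%N by lia.
exact: ballotSS.
Qed.

Lemma bcoef0S n : bcoef 0 n.+1 = bcoef 1 n.+1.
Proof.
by rewrite /bcoef /= subn0 subSS subn0 ballotSS ballot_diag add0r.
Qed.

(* In generating functions: [x^(e+1) C^(e+2) = x C * x^e C^(e+1)]. *)
Lemma bcoefS_conv n e :
  bcoef e.+1 n.+1 = \sum_(q < n.+1) bcoef 0 q * bcoef e (n - q).
Proof.
elim: n e => [|n IH] e.
  rewrite big_ord1 bcoefSS (@bcoef_small e.+2) // addr0.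
  by rewrite bcoef00 mul1r.
(* Inner induction, downward in [e]: [bcoefSS] leads to a smaller degree, covered by [IH], and to a
   larger [e], covered by [IHd]; for [e] above the degree both sides vanish. *)
have [d] := ubnP (n.+2 - e); elim: d e => // d IHd e led.
have [le|gt] := leqP e n.+1; last first.
  rewrite bcoef_small //= big1 // => q _.
  by rewrite [bcoef e _]bcoef_small ?mulr0 //; have := ltn_ord q; lia.
rewrite bcoefSS IHd; last lia.
case: e {le led} => [|e].
  rewrite [in RHS]big_ord_recr /= subnn bcoef00 mulr1 addrC.
  congr (_ + _); rewrite big_ord_recr /= subnn (@bcoef_small 1) // mulr0 addr0.
  apply: eq_bigr => q _.
  have -> : (n.+1 - q = (n - q).+1)%N by have := ltn_ord q; lia.
  by rewrite bcoef0S.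
rewrite IH [in RHS]big_ord_recr /= subnn (@bcoef_small e.+1) // mulr0 addr0.
rewrite [X in _ + X]big_ord_recr /= subnn (@bcoef_small e.+2) // mulr0 addr0.
rewrite -big_split /=.
apply: eq_bigr => q _.
have -> : (n.+1 - q = (n - q).+1)%N by have := ltn_ord q; lia.
by rewrite [in RHS]bcoefSS mulrDr.
Qed.

Variable b : F.

Lemma Mb_bcoef n K : (n < K)%N -> Mb b n = \sum_(e < K) bcoef e n * b ^+ e.
Proof.
move=> ltnK; rewrite -(subnKC ltnK) big_split_ord /= [X in _ + X]big1 ?addr0; last first.
  by move=> e _; rewrite bcoef_small ?mul0r //=; lia.
rewrite big_mkord (reindex_inj rev_ord_inj); apply: eq_bigr => e _ /=.
have le : (e <= n)%N by rewrite -ltnS.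
by rewrite /bcoef subSS le subKn.
Qed.

(** Coefficientwise form of f = 1 + b x f + x C f, where f = C / (1 - b x C). *)
Lemma MbS n : Mb b n.+1 = b * Mb b n + \sum_(q < n.+1) bcoef 0 q * Mb b (n - q)%N.
Proof.
rewrite (@Mb_bcoef n.+1 n.+2) // big_ord_recl expr0 mulr1 /=.
rewrite (eq_bigr (fun e : 'I_n.+1 => b * (bcoef e n * b ^+ e)
                    + bcoef e.+2 n.+1 * b ^+ e.+1)); last first.
  by move=> e _; rewrite /bump /= add1n bcoefSS exprS; ring.
rewrite big_split /= -mulr_sumr -Mb_bcoef // addrCA; congr (_ + _).
(* Read as [bcoef 1 n.+1], the constant term becomes the missing e = 0 term of the remaining sum, to
   which [bcoefS_conv] then applies. *)
rewrite bcoef0S.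
transitivity (\sum_(e < n.+2) bcoef e.+1 n.+1 * b ^+ e).
  by rewrite [RHS]big_ord_recl expr0 mulr1.
rewrite big_ord_recr /= bcoef_small // mul0r addr0.
rewrite (eq_bigr (fun e : 'I_n.+1 =>
  \sum_(q < n.+1) bcoef 0 q * (bcoef e (n - q) * b ^+ e))); last first.
  move=> e _; rewrite bcoefS_conv mulr_suml.
  by apply: eq_bigr => q _; rewrite mulrA.
rewrite exchange_big /=; apply: eq_bigr => q _.
by rewrite -mulr_sumr -Mb_bcoef // ltnS leq_subr.
Qed.

Lemma Mb0 : Mb b 0%N = 1.
Proof. by rewrite /Mb big_nat1 subr0 mulr1. Qed.

(* The coefficients of [1 - b x - x C(x)], the inverse of the generating
   function of [Mb b]. *)
Definition Minv (p : nat) : F :=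
  match p with 0 => 1 | 1 => - (1 + b) | p.+1 => - bcoef 0 p end.

Lemma Minv_conv s : \sum_(p < s.+2) Minv p * Mb b (s.+1 - p)%N = 0.
Proof.
rewrite big_ord_recl mul1r subn0 MbS !big_ord_recl /= /bump /=.
rewrite bcoef00 mul1r subn0 subSS subn0.
set S1 := \sum_(i < s) _; set S2 := \sum_(i < s) _.
suff -> : S2 = - S1 by ring.
rewrite -sumrN; apply: eq_bigr => i _.
by rewrite !add1n /= subSS mulNr.
Qed.

End Ballot.

(** * Hankel matrices of a shifted power series *)

Section ShiftedHankel.
Variable F : comNzRingType.

(** Only the last entry of the first row is nonzero; the cofactor signs of the successive expansions
    add up to the exponent binom(m, 2). *)
Lemma det_antitriangular (g : nat -> F) m : g 0 = 1 ->
  \det (\matrix_(i < m, j < m)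
    if (m <= (i + j).+1)%N then g ((i + j).+1 - m)%N else 0) = (-1) ^+ 'C(m, 2).
Proof.
move=> g0; elim: m => [|m IH]; first by rewrite det_mx00.
rewrite (expand_det_row _ ord0) (bigD1 ord_max) //= big1 ?addr0; last first.
  move=> j; rewrite -val_eqE /= => nej; rewrite mxE /= ifN ?mul0r //.
  by have := ltn_ord j; lia.
rewrite mxE /= leqnn subnn g0 mul1r /cofactor add0n binS bin1 addnC exprD -IH.
congr (_ * \det _); apply/matrixP => i j; rewrite !mxE lift0 lift_max.
by rewrite addSn ltnS subSS.
Qed.

Variables (a : int -> F) (g : nat -> F).
Hypotheses (a_neg : forall k, a (Negz k) = 0) (a0 : a 0 = 1) (g0 : g 0 = 1).
Hypothesis g_conv : forall s, \sum_(p < s.+2) g p * a (s.+1 - p)%N = 0.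

Lemma conv_ge s K : (s.+2 <= K)%N -> \sum_(p < K) g p * a (s.+1%:Z - p%:Z) = 0.
Proof.
move=> leK; rewrite -(subnKC leK) big_split_ord /= [X in _ + X]big1 ?addr0.
  by rewrite -[RHS](g_conv s); apply: eq_bigr => p _; rewrite subzn // -ltnS.
move=> p _; have -> : s.+1%:Z - (s.+2 + p)%N%:Z = Negz p by lia.
by rewrite a_neg mulr0.
Qed.

Lemma det_hankel_shift m N :
  \det (\matrix_(i < m.+1 + N, j < m.+1 + N) a (- m%:Z + i%:Z + j%:Z)) =
  (-1) ^+ 'C(m.+1, 2) * \det (\matrix_(i < N, j < N) (- g (m.+2 + i + j)%N)).
Proof.
set A := (X in \det X = _).
pose L : 'M[F]_(m.+1 + N) := \matrix_(i, k) if (k <= i)%N then g (i - k)%N else 0.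
(* [U] is the inverse of the transpose of [L]; having it on the right-hand side of [E] leaves only
   single convolutions to compare. *)
pose U : 'M[F]_(m.+1 + N) := \matrix_(l, j) a (j%:Z - l%:Z).
pose P : 'M[F]_m.+1 :=
  \matrix_(i, j) if (m.+1 <= (i + j).+1)%N then g ((i + j).+1 - m.+1)%N else 0.
pose Q : 'M[F]_N := \matrix_(i, j) (- g (m.+2 + i + j)%N).
have detL : \det L = 1.
  rewrite det_trig; last first.
    by apply/is_trig_mxP => i j lt; rewrite mxE leqNgt lt.
  by apply: big1 => i _; rewrite mxE leqnn subnn.
have detU : \det U = 1.
  rewrite -det_tr det_trig; last first.
    apply/is_trig_mxP => i j lt; rewrite !mxE.
    have -> : i%:Z - j%:Z = Negz (j - i).-1 by lia.
    exact: a_neg.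
  by apply: big1 => i _; rewrite !mxE subrr.
have LA i j : (L *m A) i j = \sum_(k < i.+1) g k * a (i%:Z + j%:Z - m%:Z - k%:Z).
  rewrite mxE (eq_bigr (fun k : 'I_(m.+1 + N) => if (k < i.+1)%N then
      g (i - k)%N * a (- m%:Z + k%:Z + j%:Z) else 0)); last first.
    by move=> k _; rewrite !mxE ltnS; case: ifP => //; rewrite mul0r.
  rewrite -big_mkcond -(big_ord_widen _ (fun k => g (i - k)%N *
    a (- m%:Z + k%:Z + j%:Z))) // (reindex_inj rev_ord_inj).
  apply: eq_bigr => k _ /=; have le : (k <= i)%N by rewrite -ltnS.
  by rewrite subSS subKn //; congr (_ * a _); lia.
have E : L *m A = block_mx P 0 0 Q *m U.
  apply/matrixP => i j; rewrite LA mxE big_split_ord /=.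
  (* Upper rows: read from right to left, row [i0] of [P] is the row of [L] with the same index. *)
  case: (split_ordP i) => i0 ->.
    rewrite [X in _ = _ + X]big1 ?addr0; last first.
      by move=> l _; rewrite block_mxEur mxE mul0r.
    rewrite [RHS](reindex_inj rev_ord_inj) /=.
    rewrite [RHS](eq_bigr (fun k : 'I_m.+1 => if (k < i0.+1)%N then
      g (i0 - k)%N * a (- m%:Z + k%:Z + j%:Z) else 0)); last first.
      move=> k _; rewrite block_mxEul !mxE /=.
      have := ltn_ord k; have := ltn_ord i0 => ? ?.
      have -> : (m < (i0 + (m.+1 - k.+1)).+1)%N = (k < i0.+1)%N by lia.
      case: ifP => [?|]; last by rewrite mul0r.
      by congr (g _ * a _); lia.
    rewrite -big_mkcond -(big_ord_widen _ (fun k => g (i0 - k)%N *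
      a (- m%:Z + k%:Z + j%:Z))) // [RHS](reindex_inj rev_ord_inj).
    apply: eq_bigr => k _ /=; have le : (k <= i0)%N by rewrite -ltnS.
    by rewrite subSS subKn //; congr (_ * a _); lia.
  rewrite [X in _ = X + _]big1 ?add0r; last first.
    by move=> l _; rewrite block_mxEdl mxE mul0r.
  (* Lower rows: the row of [Q] supplies minus the tail of the convolution of [g] and [a] in degree
     i0 + j + 1, whose full sum is 0. *)
  apply/eqP; rewrite -subr_eq0 -sumrN /=; apply/eqP.
  rewrite -[RHS](@conv_ge (i0 + j)%N ((m.+1 + i0).+1 + N)%N); last first.
    by have := ltn_ord j; lia.
  rewrite [RHS]big_split_ord /=.
  congr (_ + _); apply: eq_bigr => l _.
    by congr (_ * a _); lia.
  rewrite block_mxEdr !mxE mulNr opprK /=.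
  by congr (g _ * a _); lia.
have := congr1 determinant E.
rewrite !det_mulmx detL detU mul1r mulr1 => ->.
by rewrite det_ublock det_antitriangular.
Qed.
End ShiftedHankel.

(** * Hankel determinants of hypergeometric moments *)

Section Hankel.
Variable F : fieldType.

Definition arith_prod (d x : F) (k : nat) : F := \prod_(l < k) (x + d * l%:R).

Lemma arith_prod0 d x : arith_prod d x 0 = 1.
Proof. exact: big_ord0. Qed.

Lemma arith_prodS d x k : arith_prod d x k.+1 = arith_prod d x k * (x + d * k%:R).
Proof. exact: big_ord_recr. Qed.

Lemma arith_prodSl d x k : arith_prod d x k.+1 = x * arith_prod d (x + d) k.
Proof.
rewrite /arith_prod big_ord_recl mulr0 addr0; congr (_ * _).
by apply: eq_bigr => l _; rewrite lift0 -natr1; ring.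
Qed.

Lemma arith_prod_neq0 d x k :
  (forall l, x + d * l%:R != 0) -> arith_prod d x k != 0.
Proof. by move=> h; apply/prodf_neq0 => l _. Qed.

Definition hankel (u : nat -> F) (N : nat) : 'M[F]_N :=
  \matrix_(i < N, j < N) u (i + j)%N.

(* Subtracting from each column the multiple of its left neighbour that kills
   the first row leaves, up to row and column factors, a Hankel matrix. *)
Lemma det_hankel_step (d x y : F) (u : nat -> F) (N : nat) :
  (forall s, y + s%:R != 0) ->
  (forall s, u s.+1 = u s * (x + d * s%:R) / (y + s%:R)) ->
  \det (hankel u N.+1) =
  u 0 * \prod_(k < N) ((k.+1)%:R * (d * y - x) / (y + k%:R))
  * \det (hankel (fun s => u s.+1 / (y + s.+1%:R)) N).
Proof.
move=> y0 uS.
pose c (j : nat) := (x + d * j%:R) / (y + j%:R).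
pose T : 'M[F]_N.+1 := \matrix_(k, j)
  ((k == j :> nat)%:R - (k.+1 == j :> nat)%:R * c j.-1).
have detT : \det T = 1.
  rewrite -det_tr det_trig; last first.
    apply/is_trig_mxP => i j lt; rewrite !mxE.
    by rewrite !gtn_eqF ?mul0r ?subr0 //; lia.
  by apply: big1 => i _; rewrite !mxE eqxx gtn_eqF // mul0r subr0.
have HT0 i : (hankel u N.+1 *m T) i ord0 = u i.
  rewrite mxE (bigD1 ord0) //= big1 ?addr0; last first.
    move=> k; rewrite -val_eqE /= => /negPf nk.
    by rewrite !mxE /= nk mul0r subr0 mulr0.
  by rewrite !mxE /= mul0r subr0 mulr1 addn0.
have HTS i (j : 'I_N) : (hankel u N.+1 *m T) i (lift ord0 j) =
    u (i + j).+1 - u (i + j)%N * c j.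
  rewrite mxE (eq_bigr (fun k : 'I_N.+1 =>
     (if k == lift ord0 j then u (i + k)%N else 0)
     - (if k == widen_ord (leqnSn N) j then u (i + k)%N * c j else 0))); last first.
    move=> k _; rewrite !mxE -!val_eqE /= /bump /= add1n eqSS.
    by do 2 case: eqP => _; rewrite ?mul0r ?mul1r ?subr0 ?sub0r ?mulr0 ?mulr1
      ?mulrBr ?mulrN ?mulr1.
  by rewrite big_split /= sumrN -!big_mkcond !big_pred1_eq lift0 addnS.
transitivity (\det (hankel u N.+1 *m T)); first by rewrite det_mulmx detT mulr1.
rewrite (expand_det_row _ ord0) (bigD1 ord0) //=.
rewrite big1 ?addr0; last first.
  move=> j; rewrite -val_eqE; case: (unliftP ord0 j) => [j0 -> _|-> //].
  by rewrite HTS /= add0n uS /c mulrA subrr mul0r.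
rewrite HT0 -mulrA; congr (_ * _); rewrite /cofactor expr0 mul1r.
(* With s = i + j + 1, c s - c j = (i + 1) (d y - x) / ((y + s) (y + j)): a row factor, a column
   factor, and 1 / (y + s), which joins the new moments. *)
have -> : row' ord0 (col' ord0 (hankel u N.+1 *m T)) =
    diag_mx (\row_k (k.+1%:R * (d * y - x)))
    *m hankel (fun s => u s.+1 / (y + s.+1%:R)) N
    *m diag_mx (\row_k (y + k%:R)^-1).
  apply/matrixP => i j; rewrite mul_mx_diag mul_diag_mx !mxE -/(hankel u N.+1).
  have := HTS (lift ord0 i) j; rewrite mxE lift0 /= addSn => ->.
  rewrite uS /c; have := y0 (i + j).+1; have := y0 j.
  rewrite -!natr1 natrD => ? ?; field.
  by apply/andP.
rewrite !det_mulmx !det_diag big_split /= -!mulrA; congr (_ * _).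
  by apply: eq_bigr => k _; rewrite mxE.
rewrite mulrC; congr (_ * _).
by apply: eq_bigr => k _; rewrite mxE.
Qed.

(** Passing to x + d and y + 2 also raises d y - x by d, so both products of step d in the numerator
    lose exactly their first factor. *)
Lemma det_hankel (d x y : F) (u : nat -> F) (N : nat) :
  (forall s, y + s%:R != 0) ->
  (forall s, u s.+1 = u s * (x + d * s%:R) / (y + s%:R)) ->
  \det (hankel u N) =
  \prod_(k < N) (u 0 * k`!%:R * arith_prod d x k * arith_prod d (d * y - x) k
    / (arith_prod 1 (y + k%:R - 1) k * arith_prod 1 y k.*2)).
Proof.
elim: N x y u => [|N IH] x y u y0 uS; first by rewrite det_mx00 big_ord0.
have y2 s : y + 2 + s%:R != 0 by rewrite -addrA -natrD.
rewrite (det_hankel_step _ y0 uS) (IH (x + d) (y + 2)) //; last first.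
  move=> s; have h1 := y0 s.+1; have h2 := y2 s; rewrite uS.
  rewrite -natr1 in h1 *; rewrite -natr1 -natr1.
  by field; rewrite h2.
rewrite [RHS]big_ord_recl /= !arith_prod0 !mulr1 invr1 mulr1 -mulrA -big_split.
congr (_ * _); apply: eq_bigr => k _; rewrite /= /bump add1n doubleS !arith_prodSl.
rewrite factS natrM uS mulr0 addr0 addr0.
have -> : y + 2 + k%:R - 1 = y + k%:R + 1 by ring.
have -> : y + k.+1%:R - 1 = y + k%:R by rewrite -natr1; ring.
have -> : d * (y + 2) - (x + d) = d * y - x + d by ring.
have -> : y + 1 + 1 = y + 2 by ring.
have nzk : arith_prod 1 (y + k%:R + 1) k != 0.
  apply: arith_prod_neq0 => l; have := y0 (k + l.+1)%N.
  by rewrite mul1r natrD -natr1 !addrA addrAC.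
have nz2k : arith_prod 1 (y + 2) k.*2 != 0.
  by apply: arith_prod_neq0 => l; rewrite mul1r.
have := y0 0; have := y0 1%N; have := y0 k; rewrite addr0 => nz nz1 nz0.
by field; rewrite nzk nz2k nz nz1 nz0.
Qed.

End Hankel.

(** * The polynomials p_m *)

Lemma pm_square (F : fieldType) m (x : F) : pm m.+1 x =
  \prod_(i < m) \prod_(j < m | (i <= j)%N)
    ((2 * x + (i.+1 + j.+1)%:R) / (i.+1 + j.+1)%:R).
Proof.
rewrite /pm big_add1 big_mkord; apply: eq_bigr => i _.
by rewrite big_add1 big_geq_mkord.
Qed.

Lemma prod_triangle (F : fieldType) m (G : nat -> nat -> F) :
  \prod_(i < m) \prod_(j < m | (i <= j)%N) G i j =
  \prod_(j < m) \prod_(i < j.+1) G i j.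
Proof.
rewrite (exchange_big_dep xpredT) //=; apply: eq_bigr => j _.
by rewrite (big_ord_widen _ (fun i => G i j) (ltn_ord j)); apply: eq_bigl.
Qed.

Lemma pmS (F : fieldType) m (x : F) : pm m.+2 x = pm m.+1 x *
  (arith_prod 1 (2 * x + m.+2%:R) m.+1 / arith_prod 1 m.+2%:R m.+1).
Proof.
rewrite !pm_square !(prod_triangle _ (fun i j =>
  (2 * x + (i.+1 + j.+1)%:R) / (i.+1 + j.+1)%:R)) big_ord_recr /=.
congr (_ * _); rewrite -prodf_div; apply: eq_bigr => i _.
have -> : (i.+1 + m.+1 = m.+2 + i)%N by lia.
by rewrite natrD mul1r addrA.
Qed.

Section NumField.
Variable F : numFieldType.

(** The substitution (i, j) -> (m + 1 - j, m + 1 - i) of the pairs 1 <= i <= j <= m turns each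
    numerator at -(N + m + 1) into minus a numerator at N, and there are binom(m + 1, 2) pairs. The
    denominators do not depend on the argument. *)
Lemma pm_reflection m N :
  pm m.+1 (- (N + m.+1)%:R) = (-1) ^+ 'C(m.+1, 2) * pm m.+1 (N%:R : F).
Proof.
pose num (x : F) : F :=
  \prod_(i < m) \prod_(j < m | (i <= j)%N) (2 * x + (i.+1 + j.+1)%:R).
have pmE x : pm m.+1 x = num x *
    (\prod_(i < m) \prod_(j < m | (i <= j)%N) ((i.+1 + j.+1)%:R)^-1).
  by rewrite pm_square -big_split; apply: eq_bigr => i _; rewrite big_split.
rewrite !pmE mulrA; congr (_ * _).
rewrite [LHS]/num (reindex_inj rev_ord_inj) /=.
under eq_bigr do rewrite (reindex_inj rev_ord_inj) /=.
rewrite (exchange_big_dep xpredT) //=.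
transitivity (\prod_(i < m) \prod_(j < m | (i <= j)%N)
   (-1 * (2 * N%:R + (i.+1 + j.+1)%:R)) : F).
  apply: eq_bigr => i _; apply: eq_big => [j|j _].
    by have := ltn_ord i; have := ltn_ord j; lia.
  have := ltn_ord i; have := ltn_ord j => lj li.
  rewrite (_ : (m - j.+1).+1 + (m - i.+1).+1 =
               m.+1 + m.+1 - (i.+1 + j.+1))%N; last lia.
  by rewrite natrB; [rewrite !natrD; ring | lia].
under eq_bigr do rewrite big_split /=.
rewrite big_split /=; congr (_ * _).
rewrite (prod_triangle _ (fun _ _ => -1)).
under eq_bigr do rewrite prodr_const card_ord.
rewrite -expr_sum; congr (_ ^+ _).
by rewrite -bin2_sum big_mkord [RHS]big_ord_recl add0n.
Qed.

Lemma pm_oppn_eq0 m n : (0 < n <= m)%N -> pm m.+1 (- n%:R : F) = 0.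
Proof.
case: n => // n /= ltnm; rewrite pm_square; apply/eqP/prodf_eq0.
exists (Ordinal ltnm) => //; apply/prodf_eq0; exists (Ordinal ltnm) => //=.
by rewrite natrD; apply/eqP; rewrite (_ : 2 * _ + _ = 0) ?mul0r //; ring.
Qed.

Lemma arith_prod_gt0 (x : F) k : 0 < x -> 0 < arith_prod 1 x k.
Proof.
by move=> x0; apply: prodr_gt0 => l _; rewrite mul1r ltr_wpDr ?ler0n.
Qed.

(** The product over [j] is the shape that the ratio of consecutive Catalan Hankel determinants
    takes in [hankel_catalan_factor]. *)
Lemma pm_succ m N : pm m.+1 N.+1%:R = pm m.+1 N%:R *
  \prod_(j < m) ((2 * N + 2 * j + 3)%:R * (2 * N + 2 * j + 4)%:R
                / ((2 * N + j + 2)%:R * (2 * N + j + 3)%:R)) :> F.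
Proof.
elim: m => [|m IH]; first by rewrite big_ord0 mulr1 !pm_square !big_ord0.
rewrite !pmS IH big_ord_recr [RHS]mulrACA; congr (_ * _) => /=.
set z : F := 2 * N%:R + m.+2%:R.
have -> : 2 * N.+1%:R + m.+2%:R = z + 1 + 1 by rewrite /z -natr1; ring.
have z0 : 0 < z by rewrite ltr_wpDl ?mulr_ge0 ?ler0n ?ltr0n.
have P0 : arith_prod 1 m.+2%:R m.+1 != 0 :> F.
  by rewrite gt_eqF // arith_prod_gt0 ?ltr0n.
(* Moving from N to N + 1 raises z by 2, so the rising product trades its two first factors for two
   new last ones. *)
have E : z * ((z + 1) * arith_prod 1 (z + 1 + 1) m.+1) =
   arith_prod 1 z m.+1 * (z + m.+1%:R) * (z + m.+2%:R).
  by rewrite -!arith_prodSl !arith_prodS !mul1r.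
have -> : (2 * N + 2 * m + 3)%:R = z + m.+1%:R :> F.
  by rewrite /z -natrM -!natrD; congr (_%:R); lia.
have -> : (2 * N + 2 * m + 4)%:R = z + m.+2%:R :> F.
  by rewrite /z -natrM -!natrD; congr (_%:R); lia.
have -> : (2 * N + m + 2)%:R = z :> F.
  by rewrite /z -natrM -!natrD; congr (_%:R); lia.
have -> : (2 * N + m + 3)%:R = z + 1 :> F.
  by rewrite /z -natrM -natrD natr1; congr (_%:R); lia.
have z1 : 0 < z + 1 by rewrite ltr_wpDr.
have zn := lt0r_neq0 z0; have z1n := lt0r_neq0 z1.
move: E; set P := arith_prod 1 (z + 1 + 1) m.+1 => E.
suff -> : P =
    arith_prod 1 z m.+1 * (z + m.+1%:R) * (z + m.+2%:R) / (z * (z + 1)).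
  by field; rewrite P0 zn z1n.
by rewrite -E; field; rewrite zn z1n.
Qed.
End NumField.

(** * Catalan Hankel determinants and the final evaluation *)

Section Catalan.
Variable F : numFieldType.

(** Follows from (n + 1) C_n = binom(2n, n); it makes the Catalan numbers hypergeometric moments
    with d = 4. *)
Lemma catalanS n :
  bcoef F 0 n.+1 = bcoef F 0 n * (4 * n%:R + 2) / n.+2%:R.
Proof.
have catE k : k.+1%:R * bcoef F 0 k = 'C(k.*2, k)%:R.
  rewrite /bcoef subn0 /ballot addnn; case: k => [|k]; first by rewrite mul1r subr0.
  have := mul_bin_left (k.+1).*2 k.
  have -> : ((k.+1).*2 - k = k.+2)%N by lia.
  move/(congr1 (GRing.natmul (1 : F))); rewrite !natrM mulrBr => <-.
  by rewrite -[k.+2%:R]natr1; ring.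
have E : (n.+1 * 'C((n.+1).*2, n.+1) = (4 * n + 2) * 'C(n.*2, n))%N.
  have := mul_bin_diag (n.*2).+2 n; have := mul_bin_left (n.*2).+1 n.
  have := mul_bin_diag (n.*2).+1 n; rewrite doubleS /=.
  have -> : ((n.*2).+1 - n = n.+1)%N by lia.
  lia.
have n1 : n.+1%:R != 0 :> F by rewrite pnatr_eq0.
have n2 : n.+2%:R != 0 :> F by rewrite pnatr_eq0.
apply: (mulfI n1); apply: (mulfI n2); rewrite mulrCA catE -[LHS]natrM E natrM -catE.
by rewrite natrD natrM; field; rewrite -natrD pnatr_eq0.
Qed.

Lemma arith_prod_shift (d x : F) k : x != 0 ->
  arith_prod d (x + d) k = arith_prod d x k * (x + d * k%:R) / x.
Proof. by move=> x0; rewrite -arith_prodS arith_prodSl mulrC mulKf. Qed.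

(** The case m = 0 of [hankel_catalan_factor]: the Hankel determinants of C_(1+i+j) are all 1. *)
Lemma arith_prod_catalan k :
  k`!%:R * arith_prod 4 6 k * arith_prod 4 6 k =
  arith_prod 1 (2 + k%:R) k * arith_prod 1 3 k.*2 :> F.
Proof.
elim: k => [|k IH]; first by rewrite !arith_prod0 !mulr1.
have k2 : 2 + k%:R != 0 :> F by rewrite -natrD pnatr_eq0.
rewrite doubleS !arith_prodS -[2 + k.+1%:R](_ : 2 + k%:R + 1 = _); last first.
  by rewrite -[k.+1%:R]natr1 addrA.
rewrite arith_prod_shift // factS natrM.
set P := arith_prod 4 6 k in IH *.
transitivity (k`!%:R * P * P * ((k%:R + 1) * (6 + 4 * k%:R) ^+ 2)); first by ring.
rewrite IH -[(k.*2).+1%:R]natr1.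
rewrite (_ : k.*2%:R = 2 * k%:R); last by rewrite -mul2n natrM.
by field.
Qed.

(** The left side is the factor at [k] in [det_hankel] for the moments C_(m+1+s): x = 4 (m + 1) + 2,
    y = m + 3, and d y - x = 6 for every m. Raising m shifts each remaining product by one step, so
    only end factors change. *)
Lemma hankel_catalan_factor m k :
  bcoef F 0 m.+1 * k`!%:R * arith_prod 4 (4 * m.+1%:R + 2) k * arith_prod 4 6 k
    / (arith_prod 1 (m.+2%:R + k%:R) k * arith_prod 1 m.+3%:R k.*2) =
  \prod_(j < m) ((2 * k + 2 * j + 3)%:R * (2 * k + 2 * j + 4)%:R
                / ((2 * k + j + 2)%:R * (2 * k + j + 3)%:R)).
Proof.
elim: m => [|m IH].
  rewrite big_ord0 bcoef0S /bcoef /= ballot0 mul1r.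
  rewrite (_ : 4 * 1 + 2 = 6) ?arith_prod_catalan; last by ring.
  by rewrite divff // mulf_neq0 ?lt0r_neq0 ?arith_prod_gt0 // -natrD ltr0n.
rewrite big_ord_recr /= -IH catalanS.
have -> : 4 * m.+2%:R + 2 = 4 * m.+1%:R + 2 + 4 :> F.
  by rewrite -[m.+2%:R]natr1; ring.
have -> : m.+3%:R + k%:R = m.+2%:R + k%:R + 1 :> F.
  by rewrite -[m.+3%:R]natr1; ring.
rewrite -[m.+4%:R]natr1.
have A0 : 4 * m.+1%:R + 2 != 0 :> F by rewrite -natrM -natrD pnatr_eq0.
have B0 : m.+2%:R + k%:R != 0 :> F by rewrite -natrD pnatr_eq0.
have C0 : m.+3%:R != 0 :> F by rewrite pnatr_eq0.
rewrite !arith_prod_shift //.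
have P1 : arith_prod 1 (m.+2%:R + k%:R) k != 0 :> F.
  by rewrite lt0r_neq0 // arith_prod_gt0 // -natrD ltr0n.
have P2 : arith_prod 1 m.+3%:R k.*2 != 0 :> F.
  by rewrite lt0r_neq0 // arith_prod_gt0 // ltr0n.
have -> : m.+2%:R + k%:R + 1 * k%:R = (2 * k + m + 2)%:R :> F.
  by rewrite mul1r -!natrD; congr (_%:R); lia.
have -> : m.+3%:R + 1 * (k.*2)%:R = (2 * k + m + 3)%:R :> F.
  by rewrite mul1r -!natrD; congr (_%:R); lia.
have -> : 4 * m.+1%:R + 2 + 4 * k%:R = 2 * (2 * k + 2 * m + 3)%:R :> F.
  by rewrite -!natrM -!natrD; congr (_%:R); lia.
have -> : (2 * k + 2 * m + 4)%:R = 2 * (m.+2%:R + k%:R) :> F.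
  by rewrite -!natrD -natrM; congr (_%:R); lia.
have D1 : (2 * k + m + 2)%:R != 0 :> F by rewrite pnatr_eq0; lia.
have D2 : (2 * k + m + 3)%:R != 0 :> F by rewrite pnatr_eq0; lia.
move: (arith_prod 1 (m.+2%:R + k%:R) k) P1 => p p0.
move: (arith_prod 1 m.+3%:R k.*2) P2 => q q0.
move: (4 * m.+1%:R + 2) A0 (m.+2%:R + k%:R) B0 m.+3%:R C0 => a a0 c c0 d d0.
move: (2 * k + m + 2)%:R D1 (2 * k + m + 3)%:R D2 => e e0 f f0.
by field; rewrite p0 q0 a0 c0 d0 e0 f0.
Qed.

Lemma det_hankel_catalan m N :
  \det (hankel (fun s => bcoef F 0 (m.+1 + s)) N) = pm m.+1 N%:R.
Proof.
rewrite (@det_hankel _ 4 (4 * m.+1%:R + 2) m.+3%:R); first last.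
- move=> s; rewrite addnS catalanS natrD; congr (_ * _ / _); first by ring.
  by rewrite -natrD; congr (_%:R); lia.
- by move=> s; rewrite -natrD pnatr_eq0.
elim: N => [|N IH].
  rewrite big_ord0 pm_square; apply/esym/big1 => i _; apply: big1 => j _.
  by rewrite mulr0 add0r divff // pnatr_eq0.
rewrite big_ord_recr IH pm_succ -hankel_catalan_factor addn0 /=.
have -> : 4 * m.+3%:R - (4 * m.+1%:R + 2) = 6 :> F by rewrite -!natr1; ring.
by have -> : m.+3%:R + N%:R - 1 = m.+2%:R + N%:R :> F;
  [rewrite -[m.+3%:R]natr1; ring|].
Qed.

Lemma Dm_neg (b : F) m n : Dm b (- m%:Z) n = pm m.+1 (- n%:R).
Proof.
have [lt|le] := ltnP m n.
  rewrite -(subnKC lt) /Dm; move: (n - m.+1)%N => N.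
  rewrite (det_hankel_shift (g := Minv b)) //; first last.
  - exact: Minv_conv.
  - exact: Mb0.
  rewrite [in RHS]addnC pm_reflection -det_hankel_catalan; congr (_ * \det _).
  (* The index m + 2 + i + j is at least 2, where [Minv] is minus a Catalan number; this is where b
     drops out. *)
  by apply/matrixP => i j; rewrite !mxE /= opprK addSn addSn /= -addnA.
case: n le => [|n] le.
  rewrite /Dm det_mx00 pm_square; apply/esym/big1 => i _; apply: big1 => j _.
  by rewrite oppr0 mulr0 add0r divff // pnatr_eq0.
rewrite pm_oppn_eq0 // /Dm (expand_det_row _ ord0) big1 // => j _; rewrite mxE.
have -> : - m%:Z + (ord0 : 'I_n.+1)%:Z + j%:Z = Negz (m - j).-1.
  by have := ltn_ord j; rewrite /=; lia.
by rewrite mul0r.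
Qed.
End Catalan.

Theorem theorem6 (R : realType) (b : R[i]) (m : nat) (n : nat) :
  (1 <= m)%N -> Dm b (- (m%:Z)) n = pm m.+1 (- (n%:R)).
Proof. by move=> _; exact: Dm_neg. Qed.
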